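(* Let $(G,\tau,\partial)$ be a Polish topometric group admitting (topometric) ample generics. Then $G$ has the small density property: whenever $H\colon G \to [0,\infty]$ is a graded subgroup which is lower semi-continuous with respect to $\partial$ and whose index $[G:H]$ is strictly less than $2^{\aleph_0}$, $H$ is upper semi-continuous (and hence continuous) with respect to $\tau$.
   Context: A Polish topometric group is a triple $(G,\tau,\partial)$ where $(G,\tau)$ is a Polish group and $\partial$ is a complete bi-invariant metric on $G$ whose topology refines $\tau$ and which is $\tau$-lower semi-continuous, i.e. $\{(g,h)\colon \partial(g,h) \leq r\}$ is $\tau$-closed in $G \times G$ for every $r$. It has (topometric) ample generics if for every $n \in \mathbb{N}$ there is $(g_1,\ldots,g_n) \in G^n$ such that the $\partial$-closure (for the maximum metric on $G^n$) of $\{(kg_1k^{-1},\ldots,kg_nk^{-1}) \colon k \in G\}$ is co-meagre in $(G^n,\tau)$. A graded subgroup is a function $H\colon G \to [0,\infty]$ with $H(1)=0$, $H(x)=H(x^{-1})$ and $H(hg)\leq H(h)+H(g)$ for all $g,h$. It defines the left-invariant pseudo-metric $d_H(g,h) = H(g^{-1}h)$ (possibly taking value $\infty$), and the index $[G:H]$ is the density character of $d_H$, i.e. the least cardinality of a $d_H$-dense subset of $G$. $H$ is $\partial$-closed if it is lower semi-continuous for the topology of $\partial$. *)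

(* Defs.v *)
From HB Require Import structures.
From mathcomp Require Import all_boot all_order all_algebra.
From mathcomp Require Import all_classical all_reals all_analysis.
Set Implicit Arguments. Unset Strict Implicit. Unset Printing Implicit Defensive.
Import Order.TTheory GRing.Theory Num.Theory.
Local Open Scope classical_set_scope.
Local Open Scope ring_scope.

Section Defs.
Variable R : realType.

Definition is_group (G : Type) (mul : G -> G -> G) (inv : G -> G) (one : G) :=
  [/\ forall x y z, mul x (mul y z) = mul (mul x y) z,
      forall x, mul one x = x, forall x, mul x one = x,
      forall x, mul (inv x) x = one & forall x, mul x (inv x) = one].

Definition is_metric (G : Type) (m : G -> G -> R) :=
  [/\ forall x y, 0 <= m x y, forall x y, m x y = 0 <-> x = y,
      forall x y, m x y = m y x &
      forall x y z, m x z <= m x y + m y z].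

Definition metric_open (G : Type) (m : G -> G -> R) (A : set G) :=
  forall x, A x -> exists2 e : R, 0 < e & forall y, m x y < e -> A y.
Definition metric_closed (G : Type) (m : G -> G -> R) (A : set G) :=
  metric_open m (~` A).

Definition metric_complete (G : Type) (m : G -> G -> R) :=
  forall u : nat -> G,
    (forall e : R, 0 < e -> exists N, forall p q, (N <= p)%N -> (N <= q)%N ->
         m (u p) (u q) < e) ->
    exists l, forall e : R, 0 < e -> exists N, forall p, (N <= p)%N -> m (u p) l < e.

Definition separable_space (T : topologicalType) :=
  exists D : set T, countable D /\ closure D = setT.

Definition polish_space (T : topologicalType) :=
  separable_space T /\
  exists m : T -> T -> R, [/\ is_metric m, metric_complete m &
                               forall A : set T, open A <-> metric_open m A].

Definition topological_group (G : topologicalType)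
    (mul : G -> G -> G) (inv : G -> G) (one : G) :=
  is_group mul inv one /\
  continuous (fun p : G * G => mul p.1 (inv p.2)).

Definition polish_group (G : topologicalType)
    (mul : G -> G -> G) (inv : G -> G) (one : G) :=
  topological_group mul inv one /\ polish_space G.

Definition polish_topometric_group (G : topologicalType)
    (mul : G -> G -> G) (inv : G -> G) (one : G) (d : G -> G -> R) :=
  [/\ polish_group mul inv one,
      is_metric d /\ metric_complete d,
      (forall k g h, d (mul k g) (mul k h) = d g h /\ d (mul g k) (mul h k) = d g h),
      (forall A : set G, open A -> metric_open d A) &
      (forall r : R, closed [set p : G * G | d p.1 p.2 <= r])].

Definition nowhere_dense (T : topologicalType) (A : set T) :=
  interior (closure A) = set0.
Definition meagre (T : topologicalType) (A : set T) :=
  exists F : nat -> set T, (forall n, nowhere_dense (F n)) /\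
                           A `<=` \bigcup_n F n.
Definition comeagre (T : topologicalType) (A : set T) := meagre (~` A).

Definition conj_orbit_closure (G : Type) (mul : G -> G -> G) (inv : G -> G)
    (d : G -> G -> R) (n : nat) (g : 'I_n -> G) : set ('I_n -> G) :=
  [set x | forall e : R, 0 < e -> exists k : G,
           forall i, d (x i) (mul (mul k (g i)) (inv k)) < e].

Definition ample_generics (G : topologicalType)
    (mul : G -> G -> G) (inv : G -> G) (d : G -> G -> R) :=
  forall n : nat, exists g : 'I_n -> G,
    @comeagre {ptws 'I_n -> G} (conj_orbit_closure mul inv d g).

Definition graded_subgroup (G : Type) (mul : G -> G -> G) (inv : G -> G)
    (one : G) (H : G -> \bar R) :=
  [/\ forall x, (0 <= H x)%E, H one = 0%E,
      forall x, H x = H (inv x) &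
      forall g h, (H (mul h g) <= H h + H g)%E].

(* d_H(g,h) = H(g^{-1} h); a set D is d_H-dense *)
Definition dH_dense (G : Type) (mul : G -> G -> G) (inv : G -> G)
    (H : G -> \bar R) (D : set G) :=
  forall g (e : R), 0 < e -> exists2 x, D x & (H (mul (inv g) x) < e%:E)%E.

(* [G : H] < 2^aleph_0: there is a d_H-dense set of cardinality < continuum,
   i.e. into which (nat -> bool) does not inject. *)
Definition index_lt_continuum (G : Type) (mul : G -> G -> G) (inv : G -> G)
    (H : G -> \bar R) :=
  exists D : set G, dH_dense mul inv H D /\
    ~ (exists f : (nat -> bool) -> G, injective f /\ (forall s, D (f s))).

Definition metric_lsc (G : Type) (d : G -> G -> R) (H : G -> \bar R) :=
  forall r : R, metric_closed d [set x | (H x <= r%:E)%E].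

Definition tau_usc (G : topologicalType) (H : G -> \bar R) :=
  forall r : R, open [set x | (H x < r%:E)%E].

End Defs.

(* Main.v *)
Require Import Defs.
From HB Require Import structures.
From mathcomp Require Import all_boot all_order all_algebra.
From mathcomp Require Import all_classical all_reals all_analysis.
From mathcomp Require Import lra.
Set Implicit Arguments. Unset Strict Implicit. Unset Printing Implicit Defensive.
Import Order.TTheory GRing.Theory Num.Theory.
Local Open Scope classical_set_scope.
Local Open Scope ring_scope.

(* If [H < c] is not a neighbourhood of 1, then by Pettis' argument [H > c / 2] is
   nonmeagre in every nonempty open set, while a small index makes every sublevel
   set [H <= delta] nonmeagre, and even a neighbourhood of 1 for the metric d.
   Ample generics then allow one to build, along a binary tree, generic tuples whose
   next coordinate is taken either in [H <= delta] or in [H > c / 2], together with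
   elements very close to 1 that conjugate one choice almost to the other while
   almost fixing the earlier coordinates. The infinite products f(x) along the
   branches satisfy: if x and y split, f(y)^-1 f(x) conjugates an element of small
   H d-close to an element of large H, so H (f(y)^-1 f(x)) is bounded below. This
   yields continuum many uniformly d_H-separated points, contradicting the index. *)

(** * Baire category *)

Section Category.
Variable T : topologicalType.

Lemma nowhere_denseP (A : set T) :
  nowhere_dense A <-> forall U, open U -> U !=set0 ->
    exists V, [/\ open V, V !=set0, V `<=` U & V `<=` ~` A].
Proof.
split=> [nA U oU [x Ux]|nA].
  have oV : open (U `&` ~` closure A).
    by apply: openI => //; apply: closed_openC; exact: closed_closure.
  exists (U `&` ~` closure A); split=> //.
  - apply: contrapT => /nonemptyPn V0.
    suff : (closure A)° x by rewrite nA.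
    apply: filterS (open_nbhs_nbhs (conj oU Ux)) => y Uy; apply: contrapT => nAy.
    by have : (U `&` ~` closure A) y by []; rewrite V0.
  - by move=> y [_ nAy] Ay; apply: nAy; exact: subset_closure.
rewrite /nowhere_dense -subset0 => x Ix.
have [|V [oV [y Vy] VU VA]] := nA (closure A)° (open_interior _); first by exists x.
have /(_ V (open_nbhs_nbhs (conj oV Vy))) [z [Az Vz]] := interior_subset (VU _ Vy).
exact: VA Vz Az.
Qed.

Lemma meagreS (A B : set T) : A `<=` B -> meagre B -> meagre A.
Proof. by move=> AB [F [nF BF]]; exists F; split=> // x /AB; exact: BF. Qed.

Lemma nowhere_dense_meagre (A : set T) : nowhere_dense A -> meagre A.
Proof. by move=> nA; exists (fun=> A); split=> // x Ax; exists 0%N. Qed.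

Lemma nowhere_dense0 : nowhere_dense (@set0 T).
Proof. by apply/nowhere_denseP => U oU U0; exists U; split=> // x _ []. Qed.

Lemma meagre_bigcup (A : nat -> set T) :
  (forall n, meagre (A n)) -> meagre (\bigcup_n A n).
Proof.
move=> /choice[F FA].
exists (fun k => if unpickle k is Some (n, i) then F n i else set0); split.
  by move=> k; case: unpickle => [[n i]|]; [case: (FA n)|exact: nowhere_dense0].
move=> x [n _ Anx]; have [i _ Fx] := (FA n).2 x Anx.
by exists (pickle (n, i)) => //=; rewrite pickleK.
Qed.

Lemma meagreU (A B : set T) : meagre A -> meagre B -> meagre (A `|` B).
Proof.
move=> mA mB.
apply: (@meagreS _ (\bigcup_n (if n == 0%N then A else B))).
  by move=> x [Ax|Bx]; [exists 0%N|exists 1%N].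
by apply: meagre_bigcup => -[|n].
Qed.

Lemma comeagre_bigcap (A : nat -> set T) :
  (forall n, comeagre (A n)) -> comeagre (\bigcap_n A n).
Proof. by move=> cA; rewrite /comeagre setC_bigcap; exact: meagre_bigcup. Qed.

Lemma comeagreS (A B : set T) : A `<=` B -> comeagre A -> comeagre B.
Proof. by move=> AB; apply: meagreS => x nB /AB. Qed.

Lemma nonmeagre_meets (A B : set T) : ~ meagre A -> comeagre B ->
  exists2 x, A x & B x.
Proof.
move=> nA cB; apply: contrapT => nAB; apply: nA.
by apply: meagreS cB => x Ax Bx; apply: nAB; exists x.
Qed.

Lemma meagre_preimage (f g : T -> T) (A : set T) : continuous f -> continuous g ->
  cancel f g -> cancel g f -> meagre A -> meagre (f @^-1` A).
Proof.
move=> cf cg fK gK [F [nF AF]]; exists (fun n => f @^-1` F n); split; last first.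
  by move=> x /AF[n _ Fx]; exists n.
move=> n; apply/nowhere_denseP => U oU [x Ux].
have [||V [oV [y Vy] VU VF]] := (nowhere_denseP _).1 (nF n) (g @^-1` U).
- by move/continuousP : cg; exact.
- by exists (f x); rewrite /= fK.
exists (f @^-1` V); split.
- by move/continuousP : cf; exact.
- by exists (g y); rewrite /= gK.
- by move=> z /VU /=; rewrite fK.
- by move=> z /VF.
Qed.

End Category.

(** * Geometrically convergent sequences *)

Section Metric.
Variables (R : realType) (G : Type) (m : G -> G -> R).
Hypothesis mM : is_metric m.

Lemma dist_ge0 x y : 0 <= m x y. Proof. by case: mM. Qed.
Lemma dist_xx x : m x x = 0. Proof. by case: mM => _ h _ _; exact/h. Qed.
Lemma dist_sym x y : m x y = m y x. Proof. by case: mM. Qed.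
Lemma dist_tri y x z : m x z <= m x y + m y z. Proof. by case: mM. Qed.

Lemma metric_open_ball x r : metric_open m [set y | m x y < r].
Proof.
move=> y /= xy; exists (r - m x y); first by rewrite subr_gt0.
by move=> z yz; have := dist_tri y x z; lra.
Qed.

Lemma half_powers (e : R) : 0 < e -> exists n, 2^-1 ^+ n < e.
Proof.
move=> e0; exists (Num.bound e^-1).
have h : e^-1 < 2 ^+ Num.bound e^-1 by exact: upper_nthrootP.
by rewrite exprVn invf_plt ?posrE ?exprn_gt0.
Qed.

Lemma half_powers_gt0 n : 0 < 2^-1 ^+ n :> R.
Proof. by rewrite exprn_gt0. Qed.

Lemma half_powers_le1 n : 2^-1 ^+ n <= 1 :> R.
Proof. by apply: exprn_ile1; lra. Qed.

Lemma half_powers_mono i n : (i <= n)%N -> 2^-1 ^+ n <= 2^-1 ^+ i :> R.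
Proof. by move=> ?; apply: ler_wiXn2l => //; lra. Qed.

(** The subtracted power makes the induction on [k] close: consecutive bounds differ by exactly
    [C * 2^-1 ^+ (n + k)]. *)
Lemma geometric_dist (u : nat -> G) (C : R) :
  (forall n, m (u n) (u n.+1) <= C * 2^-1 ^+ n) ->
  forall n k, m (u n) (u (n + k)%N) <= 2 * C * (2^-1 ^+ n - 2^-1 ^+ (n + k)).
Proof.
move=> uC n; elim=> [|k IH]; first by rewrite addn0 dist_xx; lra.
have := uC (n + k)%N; have := dist_tri (u (n + k)%N) (u n) (u (n + k.+1)%N).
by move: IH; rewrite addnS exprS; lra.
Qed.

Lemma geometric_limit (u : nat -> G) (C : R) : metric_complete m ->
  (forall n, m (u n) (u n.+1) <= C * 2^-1 ^+ n) ->
  exists l, (forall n, m (u n) l <= 2 * C * 2^-1 ^+ n) /\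
    forall e, 0 < e -> exists N, forall p, (N <= p)%N -> m (u p) l < e.
Proof.
move=> mC uC; have uD := geometric_dist uC.
have C0 : 0 <= C by have := uC 0%N; have := dist_ge0 (u 0%N) (u 1%N); rewrite expr0; lra.
have uB n k : m (u n) (u (n + k)%N) <= 2 * C * 2^-1 ^+ n.
  apply: (le_trans (uD n k)); apply: ler_wpM2l; first lra.
  by have := half_powers_gt0 (n + k); lra.
have [|l ul] := mC u.
  (* [u p] and [u q] both lie within [2 * C * 2^-1 ^+ N] of [u N]; the added 1 keeps the divisor
     positive when [C = 0]. *)
  move=> e e0; have D0 : 0 < 4 * C + 1 by lra.
  have [N Ne] := half_powers (divr_gt0 e0 D0).
  exists N => p q Np Nq.
  have := uB N (p - N)%N; have := uB N (q - N)%N; rewrite !subnKC //.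
  move: Ne; rewrite ltr_pdivlMr // mulrDr mulr1 => Ne.
  have := half_powers_gt0 N; have := dist_tri (u N) (u p) (u q).
  by rewrite (dist_sym (u p) (u N)); lra.
exists l; split=> // n; apply/ler_addgt0Pr => e e0.
have [N Nl] := ul e e0.
have := Nl (n + N)%N (leq_addl _ _); have := uB n N.
by have := dist_tri (u (n + N)%N) (u n) l; lra.
Qed.

End Metric.

(** * Local category in second countable spaces *)

Section SecondCountable.
Variables (R : realType) (T : topologicalType) (m : T -> T -> R).
Hypothesis mM : is_metric m.
Hypothesis mO : forall A : set T, open A <-> metric_open m A.

Lemma dist_open_ball x r : open [set y | m x y < r].
Proof. by apply/mO; exact: metric_open_ball. Qed.

Lemma dist_nbhsP x (A : set T) :
  nbhs x A <-> exists2 e, 0 < e & forall y, m x y < e -> A y.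
Proof.
split=> [|[e e0 eA]].
  rewrite nbhsE => -[B [oB Bx] BA]; have [e e0 eB] := (mO B).1 oB x Bx.
  by exists e => // y /eB /BA.
rewrite nbhsE; exists [set y | m x y < e]; last by move=> y /eA.
by split; [exact: dist_open_ball|rewrite /= (dist_xx mM)].
Qed.

Lemma dense_sequence (x0 : T) : separable_space T ->
  exists q : nat -> T, forall x e, 0 < e -> exists n, m x (q n) < e.
Proof.
move=> [D [/countable_injP[f fI] cD]].
have /choice[q qP] : forall n, exists x, (exists2 y, D y & f y = n) -> D x /\ f x = n.
  move=> n; have [[y Dy fy]|h] := pselect (exists2 y, D y & f y = n).
    by exists y.
  by exists x0.
exists q => x e e0.
have : closure D x by rewrite cD.
have xB : nbhs x [set y | m x y < e] by apply/dist_nbhsP; exists e.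
move=> /(_ _ xB) [y [Dy xy]]; exists (f y).
have [Dq fq] := qP (f y) (ex_intro2 _ _ y Dy erefl).
by rewrite (fI _ _ _ _ fq) ?inE.
Qed.

Variable q : nat -> T.
Hypothesis qD : forall x e, 0 < e -> exists n, m x (q n) < e.

Definition rational_ball (k : nat * nat) := [set y | m (q k.1) y < 2^-1 ^+ k.2].

Lemma rational_ball_open k : open (rational_ball k).
Proof. exact: dist_open_ball. Qed.

Lemma rational_ball_nonempty k : rational_ball k !=set0.
Proof. by exists (q k.1); rewrite /rational_ball /= (dist_xx mM) half_powers_gt0. Qed.

Lemma rational_ball_base (U : set T) x : open U -> U x ->
  exists2 k, rational_ball k x & rational_ball k `<=` U.
Proof.
move=> oU Ux; have [e e0 eU] := (mO U).1 oU x Ux.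
have [n ne] := half_powers e0.
have [i xi] := qD x (half_powers_gt0 R n.+1).
exists (i, n.+1); first by rewrite /rational_ball /= (dist_sym mM).
move=> y; rewrite /rational_ball /= => iy; apply: eU.
by have := dist_tri mM (q i) x y; move: xi iy; rewrite exprS; lra.
Qed.

(** The points at which [S] is locally of second category; they need not belong to [S]. *)
Definition heavy_points (S : set T) :=
  [set x | forall U, open U -> U x -> ~ meagre (S `&` U)].

Lemma meagre_setD_heavy S : meagre (S `\` heavy_points S).
Proof.
(* The first factor does not depend on [x]: [light k] is [S] within the ball if that is meagre, and
   empty otherwise. *)
pose light k := [set x | meagre (S `&` rational_ball k)] `&` (S `&` rational_ball k).
apply: (@meagreS _ _ (\bigcup_n
   (if unpickle n is Some k then light k else set0))); last first.
  apply: meagre_bigcup => n; case: unpickle => [k|].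
    have [mk|nk] := pselect (meagre (S `&` rational_ball k)).
      by apply: meagreS mk => x [].
    by apply: meagreS (nowhere_dense_meagre (nowhere_dense0 T)) => x [].
  exact: nowhere_dense_meagre (nowhere_dense0 T).
move=> x [Sx /existsNP[U /not_implyP[oU /not_implyP[Ux /contrapT mU]]]].
have [k kx kU] := rational_ball_base oU Ux.
exists (pickle k) => //=; rewrite pickleK; split=> //=.
by apply: meagreS mU => y [Sy /kU].
Qed.

(** The non-heavy points form an open set. If no nonempty open subset of [O] consisted of heavy
    points, the heavy points in [O] would be nowhere dense and [S] would be meagre in [O]. *)
Lemma heavy_points_open (S O : set T) : open O -> ~ meagre (S `&` O) ->
  exists O', [/\ open O', O' !=set0, O' `<=` O & O' `<=` heavy_points S].
Proof.
move=> oO nSO; apply: contrapT => nO'; apply: nSO.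
apply: (@meagreS _ _ ((S `\` heavy_points S) `|` (heavy_points S `&` O))).
  move=> x [Sx Ox]; have [hx|nhx] := pselect (heavy_points S x).
    by right.
  by left.
apply: meagreU; first exact: meagre_setD_heavy.
apply/nowhere_dense_meagre/nowhere_denseP => U oU U0.
have [UO0|UO] := pselect ((U `&` O) !=set0); last first.
  by exists U; split=> // x Ux [_ Ox]; apply: UO; exists x.
have oUO := openI oU oO.
have [x [[Ux Ox] nhx]] : exists x, (U `&` O) x /\ ~ heavy_points S x.
  apply: contrapT => h; apply: nO'; exists (U `&` O); split=> //.
  by move=> x UOx; apply: contrapT => nhx; apply: h; exists x.
move: nhx => /existsNP[W /not_implyP[oW /not_implyP[Wx /contrapT mW]]].
exists (U `&` W); split.
- exact: openI.
- by exists x.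
- by move=> y [].
- by move=> y [_ Wy] [/(_ W oW Wy)].
Qed.

End SecondCountable.

(** * Projections of closed sets *)

Section Projection.
Variables (R : realType) (X Y : topologicalType).
Variables (m : X -> X -> R) (q : nat -> X).
Hypothesis mM : is_metric m.
Hypothesis mO : forall A : set X, open A <-> metric_open m A.
Hypothesis qD : forall x e, 0 < e -> exists n, m x (q n) < e.
Variables (m' : Y -> Y -> R) (q' : nat -> Y).
Hypothesis mM' : is_metric m'.
Hypothesis mO' : forall A : set Y, open A <-> metric_open m' A.
Hypothesis qD' : forall x e, 0 < e -> exists n, m' x (q' n) < e.
Hypothesis mC' : metric_complete m'.

(* Fragment of the Baire property of analytic sets: outside a meagre set, a point
   heavy for the projection of one cell of Y is heavy for the projection of a
   smaller adjacent cell, and the chosen cells then shrink to a witness. *)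
Lemma nonmeagre_projection (F : set (X * Y)) : closed F ->
  ~ meagre [set x | exists y, F (x, y)] ->
  exists V : set X, [/\ open V, V !=set0 & meagre (V `\` [set x | exists y, F (x, y)])].
Proof.
move=> cF nS.
pose S i n := [set x | exists2 y, m' (q' i) y < 2^-1 ^+ n & F (x, y)].
have [i0 nS0] : exists i, ~ meagre (S i 0%N `&` setT).
  apply: contrapT => h; apply: nS.
  apply: (@meagreS _ _ (\bigcup_i (S i 0%N `&` setT))).
    move=> x [y Fxy]; have [i yi] := qD' y (half_powers_gt0 R 0).
    by exists i => //; split=> //; exists y => //; rewrite (dist_sym mM').
  by apply: meagre_bigcup => i; apply: contrapT => nSi; apply: h; exists i.
have [V [oV V0 _ VS]] := heavy_points_open mM mO qD openT nS0.
exists V; split=> //.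
(* Points where the descent through the cells gets stuck. The bound [2 * 2^-1 ^+ n] on centres
   expresses that a cell of level [n.+1] meets cell [i] of level [n]. *)
pose bad i n := heavy_points (S i n) `\`
  [set x | exists j, m' (q' i) (q' j) < 2 * 2^-1 ^+ n /\ heavy_points (S j n.+1) x].
have mbad i n : meagre (bad i n).
  apply/nowhere_dense_meagre/nowhere_denseP => U oU U0.
  have [Uh|nUh] := pselect (exists2 x, U x & heavy_points (S i n) x); last first.
    by exists U; split=> // x Ux [hx _]; apply: nUh; exists x.
  have [x Ux /(_ U oU Ux) nSU] := Uh.
  have [j [ij nSj]] : exists j, m' (q' i) (q' j) < 2 * 2^-1 ^+ n /\
      ~ meagre (S j n.+1 `&` U).
    apply: contrapT => h; apply: nSU.
    pose close j := [set _ : X | m' (q' i) (q' j) < 2 * 2^-1 ^+ n] `&` (S j n.+1 `&` U).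
    apply: (@meagreS _ _ (\bigcup_j close j)).
      move=> z [[y iy Fzy] Uz]; have [j yj] := qD' y (half_powers_gt0 R n.+1).
      exists j => //; split; last by split=> //; exists y => //; rewrite (dist_sym mM').
      have := dist_tri mM' y (q' i) (q' j).
      by move: yj iy => /=; rewrite exprS; have := half_powers_gt0 R n; lra.
    apply: meagre_bigcup => j.
    have [ij|nij] := pselect (m' (q' i) (q' j) < 2 * 2^-1 ^+ n).
      have : meagre (S j n.+1 `&` U) by apply: contrapT => ?; apply: h; exists j.
      by apply: meagreS => z [].
    by apply: meagreS (nowhere_dense_meagre (nowhere_dense0 X)) => z [].
  have [V' [oV' V'0 V'U V'S]] := heavy_points_open mM mO qD oU nSj.
  by exists V'; split=> // z /V'S hz [_]; apply; exists j.
apply: (@meagreS _ _ (\bigcup_i \bigcup_n bad i n)); last first.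
  by apply: meagre_bigcup => i; exact: meagre_bigcup.
move=> x [Vx nSx]; apply: contrapT => good; apply: nSx.
have /choice[next nextP] : forall p : nat * nat, exists j,
    heavy_points (S p.1 p.2) x ->
    m' (q' p.1) (q' j) < 2 * 2^-1 ^+ p.2 /\ heavy_points (S j p.2.+1) x.
  move=> [i n] /=; have [[j hj]|nj] := pselect (exists j,
     m' (q' i) (q' j) < 2 * 2^-1 ^+ n /\ heavy_points (S j n.+1) x).
    by exists j.
  by exists 0%N => hx; exfalso; apply: good; exists i => //; exists n.
pose c := fix c n := if n is k.+1 then next (c k, k) else i0.
have hc n : heavy_points (S (c n) n) x.
  elim: n => [|n IH]; last by have [] := nextP (c n, n) IH.
  by move: (VS x Vx) => h U oU Ux; apply: h.
have cC n : m' (q' (c n)) (q' (c n.+1)) <= 2 * 2^-1 ^+ n.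
  by have [/ltW] := nextP (c n, n) (hc n).
have [y [cy _]] := geometric_limit mM' mC' cC.
exists y; apply: cF => B [[B1 B2] /= [nB1 nB2] B12].
have [e e0 eB2] := (dist_nbhsP mM' mO' _ _).1 nB2.
(* The limit [y] is within [4 * 2^-1 ^+ n] of the centre of the [n]-th cell, and any point of that
   cell is within one more [2^-1 ^+ n]. *)
have [n ne] : exists n, 5 * 2^-1 ^+ n < e.
  have e5 : 0 < e / 5 by lra.
  by have [n] := half_powers e5; exists n; lra.
(* Heaviness is used only to get a nonempty intersection: some [z] near [x] has a witness in the
   [n]-th cell, hence near [y], and [F] is closed. *)
apply: contrapT => noB; apply: (hc n _ (open_interior B1) nB1).
apply: meagreS (nowhere_dense_meagre (nowhere_dense0 X)) => z [[y' cy' Fz] Bz].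
exfalso; apply: noB; exists (z, y'); split=> //; apply: B12; split=> /=.
  exact: interior_subset.
apply: eB2; have := cy n; have := dist_tri mM' (q' (c n)) y y'.
by rewrite (dist_sym mM' y (q' _)); lra.
Qed.

End Projection.
(** * Cantor schemes *)

Section CantorSchemes.

(* Prefixes are stored with the most recent bit first. *)
Fixpoint prefix (x : nat -> bool) (n : nat) : seq bool :=
  if n is k.+1 then x k :: prefix x k else [::].

Lemma size_prefix x n : size (prefix x n) = n.
Proof. by elim: n => //= n ->. Qed.

Lemma prefix_split x y : x <> y -> exists n, prefix x n = prefix y n /\ x n = ~~ y n.
Proof.
move=> xy; have ex : exists n, x n != y n.
  apply: contrapT => h; apply: xy; apply/funext => n.
  by apply/eqP; apply: contrapT => /negP hn; apply: h; exists n.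
case: (ex_minnP ex) => n xyn nmin; exists n; split; last first.
  by move: xyn; case: (x n); case: (y n).
have : forall k, (k <= n)%N -> prefix x k = prefix y k; last exact.
elim=> //= k IH kn; rewrite IH ?(ltnW kn) //; congr cons.
by apply/eqP; apply: contrapT => /negP /nmin; rewrite leqNgt kn.
Qed.

Lemma prefix_neq x y n k : x n <> y n -> (n < k)%N -> prefix x k <> prefix y k.
Proof.
move=> xy; elim: k => // k IH; rewrite ltnS leq_eqVlt => /orP[/eqP<- [] //|nk [_]].
exact: IH.
Qed.

Variables (R : realType) (G : Type) (m : G -> G -> R).
Hypotheses (mM : is_metric m) (mC : metric_complete m).

Lemma tree_limit (p : seq bool -> G) (C : R) :
  (forall b s, m (p s) (p (b :: s)) <= C * 2^-1 ^+ size s) ->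
  exists f : (nat -> bool) -> G,
    forall x n, m (p (prefix x n)) (f x) <= 2 * C * 2^-1 ^+ n.
Proof.
move=> pC.
suff /choice[f fP] : forall x, exists l, forall n,
    m (p (prefix x n)) l <= 2 * C * 2^-1 ^+ n by exists f.
move=> x; have [|l [hl _]] := @geometric_limit R G m mM (fun n => p (prefix x n)) C mC.
  by move=> n; have := pC (x n) (prefix x n); rewrite size_prefix.
by exists l.
Qed.

(** Mycielski's independent set theorem; the hypothesis makes each relation [Q k] nowhere dense in
    the square. A Cantor scheme of balls is built in which distinct words of length [n.+1] avoid
    [Q k] for all [k <= n]. *)
Lemma mycielski (Q : nat -> G -> G -> Prop) :
  (forall k g h r, 0 < r -> exists g' h' r', [/\ 0 < r',
      forall a, m g' a < r' -> m g a < r,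
      forall a, m h' a < r' -> m h a < r &
      forall a b, m g' a < r' -> m h' b < r' -> ~ Q k a b]) ->
  G -> exists f : (nat -> bool) -> G, forall x y, x <> y -> forall k, ~ Q k (f x) (f y).
Proof.
move=> Qnd g0.
(* Finitely many constraints are met one at a time. All words share one radius, so a constraint
   moves two centres and shrinks every ball. *)
have refine (L : seq (nat * (seq bool * seq bool))) (c : seq bool -> G) (r : R) :
    0 < r -> exists c' r', [/\ 0 < r',
      forall s a, m (c' s) a < r' -> m (c s) a < r &
      forall k s t, (k, (s, t)) \in L -> s <> t ->
        forall a b, m (c' s) a < r' -> m (c' t) b < r' -> ~ Q k a b].
  move=> r0; elim: L => [|[k [s t]] L [c1 [r1 [r10 sub1 av1]]]]; first by exists c, r.
  have [st|st] := eqVneq s t.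
    exists c1, r1; split=> // k' s' t'; rewrite inE => /orP[/eqP[_ -> ->]|]; first by rewrite st.
    exact: av1.
  have [g [h [r2 [r20 subg subh av2]]]] := Qnd k (c1 s) (c1 t) r1 r10.
  pose r3 := Num.min r1 r2.
  have [r31 r32] : r3 <= r1 /\ r3 <= r2 by rewrite /r3 !ge_min !lexx orbT.
  pose c3 u := if u == s then g else if u == t then h else c1 u.
  have sub3 u a : m (c3 u) a < r3 -> m (c1 u) a < r1.
    rewrite /c3; case: eqVneq => [->|_] ha; first by apply: subg; lra.
    by move: ha; case: eqVneq => [->|_] ha; [apply: subh|]; lra.
  exists c3, r3; split.
  - by rewrite lt_min r10.
  - by move=> u a /sub3 /sub1.
  move=> k' s' t'; rewrite inE => /orP[/eqP[-> -> ->] _ a b|].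
    rewrite /c3 eqxx eq_sym (negbTE st) eqxx => ha hb; apply: av2; lra.
  by move=> inL st' a b /sub3 ha /sub3 hb; exact: (av1 _ _ _ inL st').
have /choice[step stepP] : forall p : nat * ((seq bool -> G) * R),
    exists st : (seq bool -> G) * R, 0 < p.2.2 -> [/\ 0 < st.2, st.2 <= 2^-1 ^+ p.1.+1,
      forall b s a, m (st.1 (b :: s)) a < st.2 -> m (p.2.1 s) a < p.2.2 / 2 &
      forall k s t, (k <= p.1)%N -> size s = p.1.+1 -> size t = p.1.+1 -> s <> t ->
        forall a b, m (st.1 s) a < st.2 -> m (st.1 t) b < st.2 -> ~ Q k a b].
  move=> [n [c r]] /=; have [r0|nr] := pselect (0 < r); last by exists (c, r).
  pose W := [seq tval s | s <- enum {: n.+1.-tuple bool}].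
  have inW s : size s = n.+1 -> s \in W.
    by move=> /eqP sn; apply/mapP; exists (Tuple sn); rewrite ?mem_enum.
  pose L := [seq (k, st) | k <- iota 0 n.+1, st <- [seq (s, t) | s <- W, t <- W]].
  pose r1 := Num.min (r / 2) (2^-1 ^+ n.+1).
  have r10 : 0 < r1 by rewrite lt_min half_powers_gt0 andbT; lra.
  have [r1r r1n] : r1 <= r / 2 /\ r1 <= 2^-1 ^+ n.+1 by rewrite /r1 !ge_min !lexx orbT.
  (* Each new word starts from the centre of its parent, with at most half the radius. *)
  have [c' [r' [r'0 sub av]]] := refine L (fun s => c (behead s)) r1 r10.
  pose r2 := Num.min r' r1.
  have r2r' : r2 <= r' by rewrite /r2 ge_min lexx.
  have r2r1 : r2 <= r1 by rewrite /r2 ge_min lexx orbT.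
  exists (c', r2) => _ /=; split.
  - by rewrite lt_min r'0.
  - exact: le_trans r2r1 r1n.
  - by move=> b s a ha; have := sub (b :: s) a; lra.
  - move=> k s t kn sn tn st a b ha hb; apply: (av k s t _ st); [|lra|lra].
    by apply: allpairs_f; [rewrite mem_iota add0n ltnS|apply: allpairs_f; exact: inW].
pose st := fix st n : (seq bool -> G) * R :=
  if n is k.+1 then step (k, st k) else (fun=> g0, 1).
have st0 n : 0 < (st n).2.
  by elim: n => [|n IH] //=; have [] := stepP (n, st n) IH.
have stn n : (st n).2 <= 2^-1 ^+ n.
  by case: n => [|n] //=; have [] := stepP (n, st n) (st0 n).
pose p s := (st (size s)).1 s.
have pS b s a : m (p (b :: s)) a < (st (size s).+1).2 -> m (p s) a < (st (size s)).2 / 2.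
  by have [_ _ h _] := stepP (size s, st (size s)) (st0 _); exact: h.
have [|f fP] := @tree_limit p 1.
  move=> b s; have := pS b s (p (b :: s)); rewrite (dist_xx mM) => /(_ (st0 _)).
  by have := stn (size s); have := st0 (size s); lra.
have pJ x n j a : m (p (prefix x (n + j)%N)) a < (st (n + j)%N).2 ->
    m (p (prefix x n)) a < (st n).2.
  elim: j a => [|j IH] a; first by rewrite addn0.
  rewrite addnS => ha; apply: IH.
  have := pS (x (n + j)%N) (prefix x (n + j)%N) a; rewrite size_prefix => /(_ ha).
  by have := st0 (n + j)%N; lra.
(* Because radii are halved, the limit does not escape to the boundary: half the radius bounds the
   later centres, and the other half the remaining distance. *)
have fin x n : m (p (prefix x n)) (f x) < (st n).2.
  have stn2 : 0 < (st n).2 / 4 by have := st0 n; lra.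
  have [k kn] := half_powers stn2.
  have kn' := half_powers_mono R (leq_addl n.+1 k).
  have h1 : m (p (prefix x n)) (p (prefix x (n.+1 + k)%N)) < (st n).2 / 2.
    have := pS (x n) (prefix x n); rewrite size_prefix; apply.
    by apply: (pJ x n.+1 k); rewrite (dist_xx mM).
  have := fP x (n.+1 + k)%N; have := dist_tri mM (p (prefix x (n.+1 + k)%N)) (p (prefix x n)) (f x).
  by lra.
exists f => x y /prefix_split[n [_ xyn]] k.
have xyn' : x n <> y n by rewrite xyn; case: (y n).
pose N := maxn n k.
have [_ _ _ av] := stepP (N, st N) (st0 N).
have fxN := fin x N.+1; have fyN := fin y N.+1.
rewrite /p size_prefix in fxN; rewrite /p size_prefix in fyN.
apply: (av k (prefix x N.+1) (prefix y N.+1)) => //.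
- exact: leq_maxr.
- exact: size_prefix.
- exact: size_prefix.
- by apply: (prefix_neq xyn'); rewrite ltnS leq_maxl.
Qed.

End CantorSchemes.
(** * Comeagre sets of tuples *)

Section KuratowskiUlam.
Variables (R : realType) (G : topologicalType) (m : G -> G -> R).
Hypothesis mM : is_metric m.
Hypothesis mO : forall A : set G, open A <-> metric_open m A.
Variable q : nat -> G.
Hypothesis qD : forall x e, 0 < e -> exists n, m x (q n) < e.
Local Notation ball := (rational_ball m q).

(** Iterated category quantifier, first coordinate outermost: the Kuratowski-Ulam form of
    comeagreness in a power of [G], on lists so that coordinates can be appended. *)
Fixpoint generic_tuples (n : nat) (P : set (seq G)) : Prop :=
  if n is k.+1 then comeagre [set y | generic_tuples k [set l | P (y :: l)]]
  else P [::].

Lemma generic_tuplesS n (P Q : set (seq G)) :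
  (forall l, size l = n -> P l -> Q l) -> generic_tuples n P -> generic_tuples n Q.
Proof.
elim: n P Q => [|n IH] P Q PQ /=; first exact: PQ.
apply: comeagreS => y; apply: IH => l ln; apply: PQ.
by rewrite /= ln.
Qed.

Lemma generic_tuples_bigcap n (P : nat -> set (seq G)) :
  (forall i, generic_tuples n (P i)) -> generic_tuples n (\bigcap_i P i).
Proof.
elim: n P => [|n IH] P hP /=; first by move=> i _; exact: hP.
apply: comeagreS (comeagre_bigcap hP) => y hy.
apply: generic_tuplesS (IH (fun i => [set l | P i (y :: l)]) _).
  by move=> l _ hl i _; exact: hl.
by move=> i; exact: hy.
Qed.

Definition in_box (k : seq (nat * nat)) (l : seq G) :=
  size l = size k /\ forall i, (i < size k)%N -> ball (nth (0, 0)%N k i) (nth (q 0) l i).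

(** Density of the interior of [P] among [n]-tuples, in terms of basic boxes. *)
Definition box_dense (n : nat) (P : set (seq G)) :=
  forall k, size k = n -> exists k', [/\ size k' = n,
    forall l, in_box k' l -> in_box k l & forall l, in_box k' l -> P l].

Lemma in_box_cons a k y l : in_box (a :: k) (y :: l) <-> ball a y /\ in_box k l.
Proof.
split=> [[[lk] h]|[ay [lk h]]].
  by split; [exact: (h 0%N)|split=> // i ik; exact: (h i.+1)].
by split=> [|[|i] ik]; rewrite /= ?lk //; exact: h.
Qed.

Lemma in_box_nonempty k : exists l, in_box k l.
Proof.
elim: k => [|a k [l kl]]; first by exists [::].
have [y ay] := rational_ball_nonempty mM q a.
by exists (y :: l); exact/in_box_cons.
Qed.

(** For each of the countably many boxes [k], the [y] whose section of [P] contains a box inside [k]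
    are comeagre. For [y] common to all [k] the section is box dense, and induction applies. *)
Lemma box_dense_generic n P : box_dense n P -> generic_tuples n P.
Proof.
elim: n P => [|n IH] P /= dP.
  by have [k' [/size0nil-> _ h]] := dP [::] erefl; exact: h.
pose E (k : seq (nat * nat)) := [set y | size k = n -> exists k', [/\ size k' = n,
    forall l, in_box k' l -> in_box k l & forall l, in_box k' l -> P (y :: l)]].
suff cE k : comeagre (E k).
  apply: (@comeagreS _ (\bigcap_i E (odflt [::] (unpickle i)))).
    move=> y hy; apply: IH => k kn.
    by have := hy (pickle k) Logic.I; rewrite pickleK; apply.
  by apply: comeagre_bigcap => i; exact: cE.
apply/nowhere_dense_meagre/nowhere_denseP => U oU [x Ux].
have [kn|kn] := pselect (size k = n); last first.
  by exists U; split=> //; [exists x|move=> y _; apply=> /kn].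
have [a _ aU] := rational_ball_base mM mO qD oU Ux.
have [] := dP (a :: k); first by rewrite /= kn.
move=> [|a' k'] [//= [k'n] sub hP].
(* Fixed points of the nonempty factors let an inclusion of boxes be read off coordinate by
   coordinate. *)
have [l0 kl0] := in_box_nonempty k'; have [y0 ay0] := rational_ball_nonempty mM q a'.
exists (ball a'); split.
- exact: rational_ball_open.
- by exists y0.
- move=> y a'y; have /sub /in_box_cons[/aU] // : in_box (a' :: k') (y :: l0).
  exact/in_box_cons.
move=> y a'y; apply=> _; exists k'; split=> // l k'l.
  by have /sub /in_box_cons[] : in_box (a' :: k') (y0 :: l) by exact/in_box_cons.
by apply: hP; exact/in_box_cons.
Qed.

Definition tuple_fun n (l : seq G) : 'I_n -> G := fun i => nth (q 0) l i.

(** The sets containing a uniform ball around [f] form a filter, which converges to [f] because each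
    coordinate does. *)
Lemma ptws_nbhs_box n (f : 'I_n -> G) (A : set {ptws 'I_n -> G}) : nbhs (f : {ptws 'I_n -> G}) A ->
  exists2 r : R, 0 < r & forall g : 'I_n -> G, (forall i, m (f i) (g i) < r) -> A g.
Proof.
pose F := [set B : set ('I_n -> G) | exists2 r : R, 0 < r &
  forall g : 'I_n -> G, (forall i, m (f i) (g i) < r) -> B g].
have FF : Filter F.
  split.
  - by exists 1.
  - move=> A1 A2 [r1 r10 h1] [r2 r20 h2]; exists (Num.min r1 r2).
      by rewrite lt_min r10.
    move=> g hg; split; [apply: h1|apply: h2] => i;
      apply: (lt_le_trans (hg i)); by rewrite ge_min lexx ?orbT.
  - by move=> A1 A2 A12 [r r0 h]; exists r => // g /h /A12.
suff /(_ A) : cvg_to F (nbhs (f : {ptws 'I_n -> G})) by [].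
apply/cvg_sup => i B [_ [[W oW <-] Wf] WB].
have [r r0 h] := (mO W).1 oW (f i) Wf.
by exists r => // g hg; apply: WB; exact: h.
Qed.

(** The complement of each nowhere dense [F i] is box dense, hence generic, and genericity survives
    countable intersections. *)
Lemma comeagre_generic_tuples n (A : set ('I_n -> G)) :
  comeagre (A : set {ptws 'I_n -> G}) -> generic_tuples n [set l | A (tuple_fun l)].
Proof.
move=> [F [nF AF]].
apply: (@generic_tuplesS n (\bigcap_i [set l | ~ F i (tuple_fun l)])).
  move=> l _ hl /=; apply: contrapT => /AF[i _ Fi]; exact: hl Fi.
apply: generic_tuples_bigcap => i; apply: box_dense_generic => k kn.
pose U : set {ptws 'I_n -> G} := [set f | forall j : 'I_n, ball (nth (0, 0)%N k j) (f j)].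
have nU f : U f -> nbhs f U.
  move=> Uf; apply: (@filter_forall {ptws 'I_n -> G} 'I_n
    (fun (j : 'I_n) (f' : {ptws 'I_n -> G}) => ball (nth (0, 0)%N k j) (f' j)) (nbhs f)) => j.
  apply: (@proj_continuous 'I_n (fun=> G) j f).
  by apply: open_nbhs_nbhs; split; [exact: rational_ball_open|exact: Uf].
have [f Uf nFf] : exists2 f, U f & ~ closure (F i) f.
  apply: contrapT => h.
  have [l0 [ls kl0]] := in_box_nonempty k.
  have Ul0 : U (tuple_fun l0) by move=> j; apply: kl0; rewrite kn.
  suff : (closure (F i))° (tuple_fun l0) by rewrite (nF i).
  apply: filterS (nU _ Ul0) => f Uf; apply: contrapT => nFf.
  by apply: h; exists f.
have nV : nbhs f (U `&` ~` closure (F i)).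
  apply: filterI; first exact: nU.
  by apply: open_nbhs_nbhs; split=> //; apply: closed_openC; exact: closed_closure.
have [r r0 fV] := ptws_nbhs_box nV.
have small j : exists a, ball a (f j) /\ ball a `<=` [set y | m (f j) y < r].
  have [|a aj ar] := @rational_ball_base R G m mM mO q qD [set y | m (f j) y < r] (f j)
    (dist_open_ball mM mO _ _); first by rewrite /= (dist_xx mM).
  by exists a.
have [a aP] := choice small.
have aV l : in_box (codom a) l -> (U `&` ~` closure (F i)) (tuple_fun l).
  move=> [_]; rewrite size_codom card_ord => h; apply: fV => j.
  have [_ ] := aP j; apply; move: (h j (ltn_ord j)).
  rewrite (nth_map j) ?size_enum_ord //.
  by rewrite nth_ord_enum.
exists (codom a); split; first by rewrite size_codom card_ord.
- move=> l h; have [Ul _] := aV l h; split; first by rewrite h.1 size_codom card_ord kn.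
  by move=> j; rewrite kn => jn; exact: (Ul (Ordinal jn)).
- by move=> l /aV[_ nFl] Fl; apply: nFl; exact: subset_closure.
Qed.

End KuratowskiUlam.
(** * Topometric groups and graded subgroups *)

Section TopometricGroup.
Variables (R : realType) (G : topologicalType).
Variables (mul : G -> G -> G) (inv : G -> G) (one : G) (d : G -> G -> R).
Hypothesis HG : polish_topometric_group mul inv one d.
Local Notation "x ** y" := (mul x y) (at level 40, left associativity).
Let conj k x := k ** x ** inv k.

Lemma mulA x y z : x ** (y ** z) = x ** y ** z.
Proof. by case: HG => -[[[]]]. Qed.
Lemma mul1 x : one ** x = x. Proof. by case: HG => -[[[]]]. Qed.
Lemma mulr1 x : x ** one = x. Proof. by case: HG => -[[[]]]. Qed.
Lemma mulV x : inv x ** x = one. Proof. by case: HG => -[[[]]]. Qed.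
Lemma mulrV x : x ** inv x = one. Proof. by case: HG => -[[[]]]. Qed.
Lemma mulK x y : inv x ** (x ** y) = y. Proof. by rewrite mulA mulV mul1. Qed.
Lemma mulVK x y : x ** (inv x ** y) = y. Proof. by rewrite mulA mulrV mul1. Qed.
Lemma mulrK x y : y ** x ** inv x = y. Proof. by rewrite -mulA mulrV mulr1. Qed.
Lemma mulrVK x y : y ** inv x ** x = y. Proof. by rewrite -mulA mulV mulr1. Qed.
Lemma invM x y : inv (x ** y) = inv y ** inv x.
Proof. by rewrite -[RHS]mul1 -(mulV (x ** y)) -!mulA mulVK mulrV mulr1. Qed.
Lemma invK x : inv (inv x) = x.
Proof. by rewrite -[LHS]mulr1 -(mulV x) mulK. Qed.
Lemma inv1 : inv one = one. Proof. by rewrite -[LHS]mul1 mulrV. Qed.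

Lemma conjM a b x : conj (a ** b) x = conj a (conj b x).
Proof. by rewrite /conj invM !mulA. Qed.
Lemma conjK a x : conj (inv a) (conj a x) = x.
Proof. by rewrite -conjM mulV /conj mul1 inv1 mulr1. Qed.

Lemma continuous_div (T : topologicalType) (f g : T -> G) :
  continuous f -> continuous g -> continuous (fun t => f t ** inv (g t)).
Proof.
move=> cf cg t; case: HG => -[[_ cG] _] _ _ _ _.
apply: (@continuous_comp _ _ _ (fun t => (f t, g t)) (fun p => mul p.1 (inv p.2))).
  by apply: cvg_pair; [exact: cf|exact: cg].
exact: cG.
Qed.

Lemma continuous_inv (T : topologicalType) (f : T -> G) :
  continuous f -> continuous (fun t => inv (f t)).
Proof.
move=> cf; have -> : (fun t => inv (f t)) = (fun t => one ** inv (f t)).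
  by apply/funext => t; rewrite mul1.
by apply: continuous_div => // t; exact: cvg_cst.
Qed.

Lemma continuous_mul (T : topologicalType) (f g : T -> G) :
  continuous f -> continuous g -> continuous (fun t => f t ** g t).
Proof.
move=> cf cg; have -> : (fun t => f t ** g t) = (fun t => f t ** inv (inv (g t))).
  by apply/funext => t; rewrite invK.
by apply: continuous_div => //; exact: continuous_inv.
Qed.

Lemma continuous_const (T : topologicalType) (a : G) : continuous (fun _ : T => a).
Proof. by move=> t; exact: cvg_cst. Qed.

Lemma continuous_mull (a : G) : continuous (fun y => a ** y).
Proof.
by apply: continuous_mul; [exact: continuous_const|move=> t; exact: cvg_id].
Qed.

Lemma continuous_mulV (a : G) : continuous (fun y => inv y ** a).
Proof.
apply: continuous_mul; last exact: continuous_const.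
by apply: continuous_inv => t; exact: cvg_id.
Qed.

Lemma continuous_conj (T : topologicalType) (f : T -> G) x :
  continuous f -> continuous (fun t => conj (f t) x).
Proof.
move=> cf; apply: continuous_div => //; apply: continuous_mul => //.
exact: continuous_const.
Qed.

Lemma closed_d_le (T : topologicalType) (f g : T -> G) r :
  continuous f -> continuous g -> closed [set t | d (f t) (g t) <= r].
Proof.
move=> cf cg; case: HG => _ _ _ _ /(_ r) cd.
have cfg : continuous (fun t => (f t, g t)).
  by move=> t; apply: cvg_pair; [exact: cf|exact: cg].
by have /continuous_closedP/(_ _ cd) := cfg.
Qed.

Lemma dM : is_metric d. Proof. by case: HG => _ []. Qed.
Lemma dC : metric_complete d. Proof. by case: HG => _ []. Qed.
Lemma d_mull k g h : d (k ** g) (k ** h) = d g h.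
Proof. by case: HG => _ _ /(_ k g h)[]. Qed.
Lemma d_mulr k g h : d (g ** k) (h ** k) = d g h.
Proof. by case: HG => _ _ /(_ k g h)[]. Qed.
Lemma d_conj k g h : d (conj k g) (conj k h) = d g h.
Proof. by rewrite /conj d_mulr d_mull. Qed.
Lemma d_inv g h : d (inv g) (inv h) = d g h.
Proof.
rewrite -(d_mull g) -(d_mulr h (g ** inv g)) mulrV mul1 -mulA mulV mulr1.
exact: dist_sym dM _ _.
Qed.
Lemma d_mul a a' b b' : d (a ** b) (a' ** b') <= d a a' + d b b'.
Proof.
by rewrite -(d_mulr b a a') -(d_mull a' b b'); exact: dist_tri dM _ _ _.
Qed.
Lemma d_conjV v x y : d (conj (inv v) x) y = d (conj v y) x.
Proof. by rewrite -(d_conj v) -conjM mulrV /conj mul1 inv1 mulr1 (dist_sym dM). Qed.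

(** * Graded subgroups of small index *)

Section GradedSubgroup.
Variable H : G -> \bar R.
Hypothesis HH : graded_subgroup mul inv one H.
Definition sublevel (r : R) := [set x | (H x <= r%:E)%E].

Lemma sublevelV r x : sublevel r x -> sublevel r (inv x).
Proof. by rewrite /sublevel /=; case: HH => _ _ <-. Qed.
Lemma sublevelM r s x y : sublevel r x -> sublevel s y -> sublevel (r + s) (x ** y).
Proof.
rewrite /sublevel /= => rx sy; case: HH => _ _ _ h.
by apply: (le_trans (h _ _)); rewrite EFinD; exact: leeD.
Qed.
Lemma sublevelS r s x : r <= s -> sublevel r x -> sublevel s x.
Proof. by move=> rs; rewrite /sublevel /= => /le_trans; apply; rewrite lee_fin. Qed.
Lemma sublevel_swap r x y : sublevel r (inv x ** y) -> sublevel r (inv y ** x).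
Proof. by move=> /sublevelV; rewrite invM invK. Qed.

Hypothesis Hidx : index_lt_continuum mul inv H.

(** Send each [f x] to a point of the dense set at distance below [c / 2]. By the triangle
    inequality separated points have distinct images, so the Cantor space would inject into the
    dense set. *)
Lemma no_separated_cantor_set (c : R) (f : (nat -> bool) -> G) : 0 < c ->
  ~ (forall x y, x <> y -> ~ sublevel c (inv (f x) ** f y)).
Proof.
move=> c0 fsep; have [D [dD nD]] := Hidx; apply: nD.
have c2 : 0 < c / 2 by lra.
have /choice[phi phiP] : forall x, exists z, D z /\ (H (inv (f x) ** z) < (c / 2)%:E)%E.
  by move=> x; have [z Dz hz] := dD (f x) _ c2; exists z.
exists phi; split; last by move=> x; have [] := phiP x.
move=> x y xy; apply: contrapT => /fsep; apply.
have -> : inv (f x) ** f y = inv (f x) ** phi x ** inv (inv (f y) ** phi x).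
  by rewrite invM invK !mulA mulrK.
have -> : c = c / 2 + c / 2 by lra.
apply: sublevelM; first by have [_ /ltW] := phiP x.
by apply: sublevelV; rewrite xy; have [_ /ltW] := phiP y.
Qed.

Hypothesis Hlsc : metric_lsc d H.

(* Otherwise pick [k_n] outside the sublevel set, converging to [one] fast:
   infinite products of the [k_n] over subsets of nat are then separated. *)
Lemma sublevel_d_nbhs (c : R) : 0 < c ->
  exists2 eta, 0 < eta & forall x, d one x < eta -> sublevel c x.
Proof.
move=> c0; apply: contrapT => hn.
have /choice[k kP] : forall e : R, exists kr : G * R, 0 < e ->
    [/\ d one kr.1 < e, 0 < kr.2 & forall y, d kr.1 y < kr.2 -> ~ sublevel c y].
  move=> e; have [e0|] := pselect (0 < e); last by exists (one, 0).
  have [x xe nx] : exists2 x, d one x < e & ~ sublevel c x.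
    apply: contrapT => h; apply: hn; exists e => // x xe.
    by apply: contrapT => nx; apply: h; exists x.
  by have [r r0 hr] := Hlsc nx; exists (x, r).
(* Each branch will end within [2 * del n.+1] of its word of length [n.+1]. So the quotient of two
   branches splitting at [n] is within [4 * del n.+1], at most half of [(k (del n)).2], of
   [(k (del n)).1], and avoids the sublevel set. *)
pose del := fix del n : R := if n is n'.+1 then
   Num.min (del n' / 2) ((k (del n')).2 / 8) else 1.
have del0 n : 0 < del n.
  elim: n => [|n IH] /=; first lra.
  by have [_ h _] := kP _ IH; rewrite lt_min; apply/andP; split; lra.
have delS n : del n.+1 <= del n / 2 by rewrite /= ge_min lexx.
have delr n : del n.+1 <= (k (del n)).2 / 8 by rewrite /= ge_min lexx orbT.
have deln n : del n <= 2^-1 ^+ n.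
  by elim: n => [|n IH]; [|have := delS n; rewrite exprS; lra].
pose p := fix p s : G := if s is b :: s' then
   (if b then p s' ** (k (del (size s'))).1 else p s') else one.
have pS b s : d (p s) (p (b :: s)) <= del (size s).
  case: b => /=; last by rewrite (dist_xx dM); have := del0 (size s); lra.
  rewrite -{1}(mulr1 (p s)) d_mull.
  by have [/ltW] := kP _ (del0 (size s)).
have [|f fP] := @tree_limit R G d dM dC p 1.
  by move=> b s; have := pS b s; have := deln (size s); lra.
have pJ x n j : d (p (prefix x n)) (p (prefix x (n + j)%N)) <=
    2 * del n - 2 * del (n + j)%N.
  elim: j => [|j IH]; first by rewrite addn0 (dist_xx dM); lra.
  have := pS (x (n + j)%N) (prefix x (n + j)%N); rewrite size_prefix => h.
  have := dist_tri dM (p (prefix x (n + j)%N)) (p (prefix x n)) (p (prefix x (n + j.+1)%N)).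
  by rewrite addnS; move: h (delS (n + j)%N) IH; rewrite [prefix x _.+1]/=; lra.
have fin x n : d (p (prefix x n)) (f x) <= 2 * del n.
  apply/ler_addgt0Pr => e e0; have e2 : 0 < e / 2 by lra.
  have [N Ne] := half_powers e2.
  have := half_powers_mono R (leq_addl n N); have := fP x (n + N)%N; have := pJ x n N.
  have := del0 (n + N)%N.
  by have := dist_tri dM (p (prefix x (n + N)%N)) (p (prefix x n)) (f x); lra.
have sep x y n : prefix x n = prefix y n -> x n -> ~~ y n ->
    ~ sublevel c (inv (f y) ** f x).
  move=> xy xn yn; have [_ r0 h] := kP _ (del0 n); apply: h.
  have fx := fin x n.+1; have fy := fin y n.+1.
  move: fx fy; rewrite /= xn (negbTE yn) -xy size_prefix => fx fy.
  rewrite -{1}(mulK (p (prefix x n)) (k (del n)).1).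
  apply: (le_lt_trans (d_mul _ _ _ _)); rewrite d_inv.
  by have := delr n; rewrite [del n.+1]/=; lra.
apply: (no_separated_cantor_set c0 (f := f)) => x y /prefix_split[n [xy xyn]].
have [yn|yn] := boolP (y n); last by move=> /sublevel_swap; apply: (sep x y n); rewrite ?xyn.
by apply: (sep y x n) => //; rewrite xyn yn.
Qed.

(** * Category in the Polish group *)

Variables (m : G -> G -> R) (q : nat -> G).
Hypothesis mM : is_metric m.
Hypothesis mC : metric_complete m.
Hypothesis mO : forall A : set G, open A <-> metric_open m A.
Hypothesis qD : forall x e, 0 < e -> exists n, m x (q n) < e.

Lemma open_mul_preimage (f : G -> G) (U : set G) : continuous f -> open U -> open (f @^-1` U).
Proof. by move=> /continuousP; apply. Qed.

(** Nowhere dense sets pull back under [inv g ** h] to nowhere dense relations, since translations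
    are homeomorphisms. Were the sublevel set meagre, [mycielski] would give a separated Cantor
    set. *)
Lemma sublevel_nonmeagre (c : R) : 0 < c -> ~ meagre (sublevel c).
Proof.
move=> c0 [F [nF HF]].
have [|f fP] := @mycielski R G m mM mC (fun k g h => F k (inv g ** h)) _ one; last first.
  apply: (no_separated_cantor_set c0 (f := f)) => x y xy /HF[k _ Fk].
  exact: fP xy k Fk.
move=> k g h r r0.
have cg : continuous (fun y => g ** y) by exact: continuous_mull.
have oU : open ((fun y => g ** y) @^-1` [set y | m h y < r]).
  by apply: open_mul_preimage => //; exact: dist_open_ball.
have [|V [oV [v Vv] VU VF]] := (nowhere_denseP _).1 (nF k) _ oU.
  by exists (inv g ** h); rewrite /= mulVK (dist_xx mM).
have cdiv : continuous (fun p : G * G => inv p.1 ** p.2).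
  apply: continuous_mul; last by move=> p; exact: cvg_snd.
  by apply: continuous_inv => p; exact: cvg_fst.
have nV : nbhs (inv g ** (g ** v)) V by apply: open_nbhs_nbhs; rewrite mulK.
have [[A B] /= [/(dist_nbhsP mM mO)[r1 r10 h1] /(dist_nbhsP mM mO)[r2 r20 h2]] AB] :=
  cdiv (g, g ** v) _ nV.
have hv : m h (g ** v) < r by exact: VU Vv.
pose r3 := Num.min r (Num.min r1 (Num.min r2 (r - m h (g ** v)))).
have r3r : r3 <= r by rewrite /r3 ge_min lexx.
have r31 : r3 <= r1 by rewrite /r3 !ge_min lexx !orbT.
have r32 : r3 <= r2 by rewrite /r3 !ge_min lexx !orbT.
have r3h : r3 <= r - m h (g ** v) by rewrite /r3 !ge_min lexx !orbT.
exists g, (g ** v), r3; split.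
- by rewrite /r3 !lt_min r0 r10 r20 subr_gt0.
- by move=> a ha; lra.
- by move=> a ha; have := dist_tri mM (g ** v) h a; lra.
- move=> a b ha hb; apply: VF; apply: (AB (a, b)).
  by split; [apply: h1|apply: h2]; lra.
Qed.

(** The Baire category theorem for [G], obtained here from a nonmeagre subset. *)
Lemma whole_nonmeagre : ~ meagre [set: G].
Proof.
by move=> mT; apply: (@sublevel_nonmeagre 1) => //; apply: meagreS mT.
Qed.

Lemma meagre_mul a (A : set G) : meagre A -> meagre ((fun x => a ** x) @^-1` A).
Proof.
have cm b : continuous (fun x => b ** x).
  exact: continuous_mull.
apply: (@meagre_preimage _ _ (fun x => inv a ** x)) => // x; first exact: mulK.
exact: mulVK.
Qed.

Lemma meagre_conj a (A : set G) : meagre A -> meagre (conj a @^-1` A).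
Proof.
have cm b : continuous (conj b).
  apply: continuous_div; last exact: continuous_const.
  exact: continuous_mull.
apply: (@meagre_preimage _ _ (conj (inv a))) => // x; first exact: conjK.
by rewrite -{1}(invK a) conjK.
Qed.

(** The translates of [U] by the dense sequence [q] cover [G]. *)
Lemma open_nonmeagre (U : set G) : open U -> U !=set0 -> ~ meagre U.
Proof.
move=> oU [u Uu] mU; apply: whole_nonmeagre.
apply: (@meagreS _ _ (\bigcup_i ((fun x => inv (q i) ** x) @^-1` U))); last first.
  by apply: meagre_bigcup => i; exact: meagre_mul.
move=> x _; have cx : continuous (fun y => inv y ** x).
  exact: continuous_mulV.
have nU : nbhs (inv (x ** inv u) ** x) U.
  by apply: open_nbhs_nbhs; rewrite invM invK mulrVK.
have /(dist_nbhsP mM mO)[e e0 eU] := cx (x ** inv u) _ nU.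
by have [i /eU] := qD (x ** inv u) e0; exists i.
Qed.

Lemma mul_nbhs_one x (A : set G) : nbhs one [set y | A (x ** y)] -> nbhs x A.
Proof.
move=> nA; have cx : continuous (fun y => inv x ** y).
  exact: continuous_mull.
have nA' : nbhs (inv x ** x) [set y | A (x ** y)] by rewrite mulV.
have nA2 : nbhs x ((fun y => inv x ** y) @^-1` [set y | A (x ** y)]) by exact: cx x _ nA'.
by apply: filterS nA2 => y /=; rewrite mulVK.
Qed.

(* Pettis' argument *)
Lemma sublevelC_nonmeagre (c : R) (U : set G) : ~ nbhs one (sublevel c) ->
  open U -> U !=set0 -> ~ meagre (~` sublevel (c / 2) `&` U).
Proof.
move=> nc oU [u Uu] mU; apply: nc.
have ci : continuous (fun g => inv g ** u).
  exact: continuous_mulV.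
have nU : nbhs (inv one ** u) U by apply: open_nbhs_nbhs; rewrite inv1 mul1.
have nU' : nbhs one ((fun g => inv g ** u) @^-1` U) by exact: ci one _ nU.
(* For such [g] the open set of [x] with [x] and [inv g ** x] in [U] contains [u], so some such [x]
   has both points in [sublevel (c / 2)]; then [g] is a quotient of the two. *)
apply: filterS nU' => g /= Ugu.
have cg : continuous (fun x => inv g ** x).
  exact: continuous_mull.
have oW : open (U `&` (fun x => inv g ** x) @^-1` U).
  by apply: openI => //; exact: open_mul_preimage.
have nW : ~ meagre (U `&` (fun x => inv g ** x) @^-1` U) by apply: open_nonmeagre => //; exists u.
have [x [Ux Ugx] [/contrapT hx /contrapT hgx]] : exists2 x,
    (U `&` (fun x => inv g ** x) @^-1` U) x &
    ~ (~ sublevel (c / 2) x) /\ ~ (~ sublevel (c / 2) (inv g ** x)).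
  apply: contrapT => h; apply: nW.
  apply: meagreS (meagreU mU (meagre_mul (inv g) mU)) => x [Ux Ugx].
  apply: contrapT => /not_orP[h1 h2]; apply: h; exists x => //.
  by split=> hx; [apply: h1|apply: h2].
have -> : g = x ** inv (inv g ** x) by rewrite invM invK mulA mulrV mul1.
have -> : c = c / 2 + c / 2 by lra.
by apply: sublevelM => //; exact: sublevelV.
Qed.

Lemma closed_limit (A : set G) (u : nat -> G) l n0 : closed A ->
  (forall e, 0 < e -> exists N, forall p, (N <= p)%N -> m (u p) l < e) ->
  (forall p, (n0 <= p)%N -> A (u p)) -> A l.
Proof.
move=> cA ul Au; apply: cA => B /(dist_nbhsP mM mO)[e e0 eB].
have [N hN] := ul e e0; exists (u (maxn n0 N)); split.
  by apply: Au; exact: leq_maxl.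
by apply: eB; rewrite (dist_sym mM); apply: hN; exact: leq_maxr.
Qed.

(** A Lindelöf argument with centres inside [S]: [k j] is a point of [S] close to [q j] when there
    is one, and [one] otherwise. *)
Lemma countable_cover (S V : set G) : S one -> nbhs one V ->
  exists k : nat -> G, (forall j, S (k j)) /\
    forall g, S g -> exists j, V (inv (k j) ** g).
Proof.
move=> S1 nV.
have cdiv : continuous (fun p : G * G => inv p.1 ** p.2).
  apply: continuous_mul; last by move=> p; exact: cvg_snd.
  by apply: continuous_inv => p; exact: cvg_fst.
have nV' : nbhs (inv one ** one) V by rewrite mulr1 inv1.
have [[A B] /= [/(dist_nbhsP mM mO)[r1 r10 h1] /(dist_nbhsP mM mO)[r2 r20 h2]] AB] :=
  cdiv (one, one) _ nV'.
pose W x := [set y | m one (inv x ** y) < r1 /\ m one (inv x ** y) < r2].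
have /choice[k kP] : forall j, exists k, S k /\
    ((exists g, S g /\ W (q j) g) -> W (q j) k).
  move=> j; have [[g [Sg Wg]]|h] := pselect (exists g, S g /\ W (q j) g).
    by exists g.
  by exists one; split=> // /h.
exists k; split=> [j|g Sg]; first by have [] := kP j.
have cg : continuous (fun y => inv y ** g).
  exact: continuous_mulV.
have nr : nbhs (inv g ** g) [set y | m one y < r1 /\ m one y < r2].
  rewrite mulV; apply: filterI; apply/(dist_nbhsP mM mO); first by exists r1.
  by exists r2.
have /(dist_nbhsP mM mO)[e e0 he] := cg g _ nr.
have [j /he Wg] := qD g e0.
have [Sk /(_ (ex_intro _ g (Logic.conj Sg Wg))) Wk] := kP j.
exists j; have -> : inv (k j) ** g = inv (inv (q j) ** k j) ** (inv (q j) ** g).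
  by rewrite invM invK !mulA mulrK.
apply: (AB (_, _)); split; [apply: h1|apply: h2].
  by case: Wk.
by case: Wg.
Qed.

(* Abstracts from ample generics the two properties needed to build tuples one
   coordinate at a time. *)
Definition generic_extension (good : set (seq G)) :=
  (forall l, good l -> comeagre [set y | good (rcons l y)]) /\
  (forall l l', good l -> good l' -> size l = size l' -> forall e : R, 0 < e ->
     exists k, forall i, (i < size l)%N -> d (conj k (nth one l i)) (nth one l' i) < e).

(** A tuple is good when, for every [k], generic extensions by [k] coordinates lie in the orbit
    closure of that length. The case [k = 0] puts good tuples of equal length near conjugates of the
    same [g n]. *)
Lemma ample_generic_extension : ample_generics mul inv d ->
  exists good, good [::] /\ generic_extension good.
Proof.
move=> Hample; pose g n := projT1 (cid (Hample n)).
have gP n : comeagre (conj_orbit_closure mul inv d (g n) : set {ptws 'I_n -> G}).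
  exact: projT2 (cid (Hample n)).
pose C n := [set l | conj_orbit_closure mul inv d (g n) (tuple_fun q l)].
have CP n : generic_tuples n (C n) by exact: (comeagre_generic_tuples mM mO qD (gP n)).
exists [set l | forall k, generic_tuples k [set l' | C (size l + k)%N (l ++ l')]].
split; first by move=> k; exact: CP.
split=> [l hl|l l' hl hl' ll' e e0].
  apply: comeagreS (comeagre_bigcap (fun k => hl k.+1)) => y hy k.
  apply: generic_tuplesS (hy k Logic.I) => l' _ /=.
  by rewrite size_rcons addSnnS cat_rcons.
have e2 : 0 < e / 2 by lra.
move: (hl 0%N) (hl' 0%N); rewrite /= !cats0 !addn0 -ll' => /(_ _ e2)[k hk] /(_ _ e2)[k' hk'].
exists (k' ** inv k) => i il; rewrite conjM.
have := hk (Ordinal il); have := hk' (Ordinal il); rewrite /tuple_fun /=.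
rewrite (set_nth_default one) -?ll' // (set_nth_default one (q 0)) //.
rewrite -!/(conj _ _) => h' h.
have := dist_tri dM (conj k' (g (size l) (Ordinal il)))
  (conj k' (conj (inv k) (nth one l i))) (nth one l' i).
rewrite (dist_sym dM) in h; rewrite (dist_sym dM) in h'.
by rewrite d_conj d_conjV; lra.
Qed.

(** * Forks and branches of generic tuples *)

Variable good : set (seq G).
Hypothesis good_ext : generic_extension good.

(* By genericity comeagrely many y are close to conjugates of y0 by elements almost
   fixing l; countably many translates of V cover these elements, so the y reached
   from y0 within V form a nonmeagre projection of a closed set. That projection is
   then comeagre in some open set, where it meets B. *)
Lemma generic_fork (l : seq G) (V A B : set G) (e : R) : 0 < e -> good l ->
  closed V -> nbhs one V -> ~ meagre A ->
  (forall U, open U -> U !=set0 -> ~ meagre (B `&` U)) ->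
  exists y0 y1 v, [/\ A y0 /\ good (rcons l y0), B y1 /\ good (rcons l y1), V v,
    forall i, (i < size l)%N -> d (conj v (nth one l i)) (nth one l i) <= e &
    d (conj v y0) y1 <= e].
Proof.
move=> e0 gl cV nV nA nB.
have [cY gconj] := good_ext.
have [y0 Ay0 gy0] := nonmeagre_meets nA (cY l gl).
pose Stab (r : R) := [set k | forall i, (i < size l)%N ->
  d (conj k (nth one l i)) (nth one l i) <= r].
have e2 : 0 < e / 2 by lra.
have S1 : Stab (e / 2) one.
  by move=> i _; rewrite /conj inv1 mul1 mulr1 (dist_xx dM); lra.
have [k [Sk kP]] := countable_cover S1 nV.
pose F := [set p : G * G | [/\ V p.2, Stab e p.2 & d (conj p.2 y0) p.1 <= e]].
(* This rests on [V] being closed and on the lower semi-continuity of [d]. *)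
have cF : closed F.
  have -> : F = (snd @^-1` V) `&` (\bigcap_(i in [set i | (i < size l)%N])
      [set p | d (conj p.2 (nth one l i)) (nth one l i) <= e] `&`
      [set p | d (conj p.2 y0) p.1 <= e]).
    by apply/seteqP; split=> p /= => [[? ? ?]|[? [? ?]]].
  have csnd : continuous (snd : G * G -> G) by move=> p; exact: cvg_snd.
  apply: closedI; first by have /continuous_closedP := csnd; apply.
  apply: closedI; last first.
    apply: closed_d_le; first exact: continuous_conj.
    by move=> p; exact: cvg_fst.
  apply: closed_bigI => i _; apply: closed_d_le; first exact: continuous_conj.
  exact: continuous_const.
have [|U [oU U0 mU]] := @nonmeagre_projection R G G m q mM mO qD m q mM mO qD mC F cF.
  (* If [T] is meagre, so are its countably many conjugates, yet they cover all [y] with [rcons l y]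
     good. Indeed [g] moving [rcons l y0] near [rcons l y] becomes [inv (k j) ** g] in [V], with
     errors [e / 2] from [g] and from [k j] on [l]. *)
  move=> mT; apply: whole_nonmeagre.
  pose T := [set y | exists v, F (y, v)].
  apply: meagreS (meagreU (cY l gl) (meagre_bigcup (fun j => meagre_conj (inv (k j)) mT))).
  move=> y _; have [gy|ngy] := pselect (good (rcons l y)); last by left.
  right; have [|g gP] := gconj _ _ gy0 gy _ _ e2; first by rewrite !size_rcons.
  rewrite size_rcons in gP.
  have Sg : Stab (e / 2) g.
    move=> i il; have := gP i (ltnW il : (i < (size l).+1)%N).
    by rewrite !nth_rcons il => /ltW.
  have gy0y : d (conj g y0) y < e / 2.
    by have := gP (size l) (ltnSn _); rewrite !nth_rcons ltnn eqxx.
  have [j Vj] := kP g Sg; exists j => //; exists (inv (k j) ** g); split=> //=.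
  - move=> i il; rewrite conjM.
    have := dist_tri dM (conj (inv (k j)) (nth one l i))
       (conj (inv (k j)) (conj g (nth one l i))) (nth one l i).
    rewrite d_conj (d_conjV _ (nth one l i)).
    by have := Sg i il; have := Sk j i il; lra.
  - by rewrite conjM d_conj; lra.
have [y1 [[By1 Uy1] nTy1] gy1] : exists2 y1,
    ((B `&` U) `\` (U `\` [set y | exists v, F (y, v)])) y1 & good (rcons l y1).
  apply: nonmeagre_meets (cY l gl) => mBU; apply: (nB U oU U0).
  apply: meagreS (meagreU mBU mU) => y BUy.
  by have [h|h] := pselect ((U `\` [set y | exists v, F (y, v)]) y); [right|left].
have [v [Vv Sv vy]] : exists v, F (y1, v) by apply: contrapT => h; apply: nTy1.
by exists y0, y1, v.
Qed.

Lemma closed_m_le (f : G -> G) x r : continuous f -> closed [set y | m x (f y) <= r].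
Proof.
move=> /continuous_closedP cf; apply: (cf [set y | m x y <= r]).
rewrite -openC; apply/mO => y /= /negP; rewrite -ltNge => ry.
exists (m x y - r); first by rewrite subr_gt0.
move=> z yz; apply/negP; rewrite -ltNge.
by have := dist_tri mM z x y; rewrite (dist_sym mM z); lra.
Qed.

(* The bit [1] multiplies the group element on the right by [inv v] for a fork
   [(y0, y1, v)] and appends [y1] to the tuple; the bit [0] only appends [y0].
   Later factors almost commute with the earlier coordinates, so two branches
   splitting here conjugate [y0] and [y1] almost to the same element. *)
Lemma conjugating_cantor_set (A B : set G) (e : R) : 0 < e -> good [::] ->
  ~ meagre A -> (forall U, open U -> U !=set0 -> ~ meagre (B `&` U)) ->
  exists f : (nat -> bool) -> G, forall x y n, prefix x n = prefix y n -> ~~ x n -> y n ->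
    exists a b, [/\ A a, B b & d (conj (inv (f y) ** f x) a) b < e].
Proof.
move=> e0 good0 nA nB.
(* For branches splitting at [n], the fork costs [eta n] and the later factors cost
   [2 * eta n.+1 = eta n] on each branch: in total at most [3 * e / 4]. *)
pose eta n : R := e / 4 * 2^-1 ^+ n.
have eta0 n : 0 < eta n by apply: mulr_gt0; [lra|exact: half_powers_gt0].
have /choice[step stepP] : forall p : G * seq G, exists t : G * G * G, good p.2 ->
    [/\ A t.1.1 /\ good (rcons p.2 t.1.1), B t.1.2 /\ good (rcons p.2 t.1.2),
      m p.1 (p.1 ** inv t.2) <= 2^-1 ^+ size p.2,
      forall i, (i < size p.2)%N ->
        d (conj t.2 (nth one p.2 i)) (nth one p.2 i) <= eta (size p.2) &
      d (conj t.2 t.1.1) t.1.2 <= eta (size p.2)].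
  move=> [F l] /=; have [gl|ngl] := pselect (good l); last by exists (one, one, one).
  have cF : continuous (fun v => F ** inv v).
    apply: continuous_div; first exact: continuous_const.
    by move=> t; exact: cvg_id.
  have [|y0 [y1 [v [? ? ? ? ?]]]] := @generic_fork l
      (* This closed neighbourhood of [one] makes the products along a branch converge for [m]. *)
      [set v | m F (F ** inv v) <= 2^-1 ^+ size l] A B (eta (size l)) (eta0 _) gl
      (@closed_m_le (fun v => F ** inv v) F _ cF) _ nA nB; last by exists (y0, y1, v).
  apply: (cF one [set y | m F y <= 2^-1 ^+ size l]); apply/(dist_nbhsP mM mO); rewrite inv1 mulr1.
  by exists (2^-1 ^+ size l); [exact: half_powers_gt0|move=> y /ltW].
pose st := fix st s : G * seq G := if s is b :: s' then
    let p := st s' in let t := step p in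
    if b then (p.1 ** inv t.2, rcons p.2 t.1.2) else (p.1, rcons p.2 t.1.1)
  else (one, [::]).
have gst s : good (st s).2.
  by elim: s => [|b s IH] //=; have [[_ ?] [_ ?] _ _ _] := stepP _ IH; case: b.
have sst s : size (st s).2 = size s.
  by elim: s => [|b s IH] //=; case: b; rewrite /= size_rcons IH.
pose p s := (st s).1.
have [|f fP] := @tree_limit R G m mM mC p 1.
  move=> b s; rewrite /p mul1r /=; have [_ _ + _ _] := stepP _ (gst s).
  by rewrite sst; case: b => //= _; rewrite (dist_xx mM) ltW ?half_powers_gt0.
(* The [i]-th coordinate along the branch [x], fixed once it has been appended. *)
pose a x i := nth one (st (prefix x i.+1)).2 i.
have aE x n i : (i < n)%N -> nth one (st (prefix x n)).2 i = a x i.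
  elim: n => // n IH; rewrite ltnS leq_eqVlt => /orP[/eqP-> //|ni].
  rewrite -IH //=; case: (x n) => /=; by rewrite nth_rcons sst size_prefix ni.
have fixS x n i : (i < n)%N ->
    d (conj (p (prefix x n.+1)) (a x i)) (conj (p (prefix x n)) (a x i)) <= eta n.
  move=> ni; rewrite -(aE x n) // /p /=.
  have [_ _ _ + _] := stepP _ (gst (prefix x n)); rewrite sst size_prefix => /(_ i ni) h.
  case: (x n) => /=; last by rewrite (dist_xx dM) ltW.
  by rewrite conjM d_conj d_conjV.
have fixJ x n i j : (i < n)%N ->
    d (conj (p (prefix x (n + j)%N)) (a x i)) (conj (p (prefix x n)) (a x i)) <=
    2 * eta n - 2 * eta (n + j)%N.
  move=> ni; elim: j => [|j IH]; first by rewrite addn0 (dist_xx dM); lra.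
  have := fixS x (n + j)%N i (ltn_addr _ ni).
  have := dist_tri dM (conj (p (prefix x (n + j)%N)) (a x i))
    (conj (p (prefix x (n + j.+1)%N)) (a x i)) (conj (p (prefix x n)) (a x i)).
  by move: IH; rewrite addnS /eta exprS; lra.
(* The products converge to [f x] only for [m]; the [d]-bound passes to the limit because it defines
   a closed set. *)
have fixlim x n i : (i < n)%N ->
    d (conj (f x) (a x i)) (conj (p (prefix x n)) (a x i)) <= 2 * eta n.
  move=> ni.
  apply: (@closed_limit [set k | d (conj k (a x i)) (conj (p (prefix x n)) (a x i)) <= 2 * eta n]
    (fun k => p (prefix x k)) (f x) n).
  - apply: closed_d_le; last exact: continuous_const.
    by apply: continuous_conj => t; exact: cvg_id.
  - move=> r r0; have r2 : 0 < r / 2 by lra.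
    have [N Nr] := half_powers r2; exists N => k Nk.
    by have := half_powers_mono R Nk; have := fP x k; lra.
  - move=> k nk /=; have := fixJ x n i (k - n)%N ni; rewrite subnKC //.
    by have := eta0 k; lra.
exists f => x y n xy xn yn; set P := prefix x n; set t := step (st P).
have [[At _] [Bt _] _ _] := stepP _ (gst P); rewrite sst size_prefix -/t => tP.
have ax : a x n = t.1.1.
  by rewrite /a /= (negbTE xn) nth_rcons sst size_prefix ltnn eqxx.
have ay : a y n = t.1.2.
  by rewrite /a /= -xy yn nth_rcons sst size_prefix ltnn eqxx.
exists t.1.1, t.1.2; split=> //.
have := fixlim x n.+1 n (ltnSn n); have := fixlim y n.+1 n (ltnSn n).
rewrite ax ay /p /= (negbTE xn) yn -xy -/P -/t /= => hy hx.
rewrite conjM d_conjV (dist_sym dM).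
have := dist_tri dM (conj ((st P).1 ** inv t.2) t.1.2) (conj (f x) t.1.1) (conj (f y) t.1.2).
have := dist_tri dM (conj (st P).1 t.1.1) (conj (f x) t.1.1) (conj ((st P).1 ** inv t.2) t.1.2).
rewrite (dist_sym dM (conj ((st P).1 ** _) _) (conj (f y) _)).
rewrite [conj (_ ** inv t.2) _]conjM d_conj (dist_sym dM t.1.1) d_conjV.
move: hx hy; rewrite /eta exprS [conj (_ ** inv t.2) _]conjM.
have := half_powers_le1 R n; move: tP; rewrite /eta; nra.
Qed.

Lemma sublevel_nbhs (c : R) : good [::] -> 0 < c -> nbhs one (sublevel c).
Proof.
move=> good0 c0; apply: contrapT => nc.
have c16 : 0 < c / 16 by lra.
have c8 : 0 < c / 8 by lra.
have [e e0 eP] := sublevel_d_nbhs c16.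
have [f fP] := conjugating_cantor_set e0 good0 (sublevel_nonmeagre c16)
  (fun U => @sublevelC_nonmeagre c U nc).
have sep x y n : prefix x n = prefix y n -> ~~ x n -> y n ->
    ~ sublevel (c / 8) (inv (f y) ** f x).
  move=> xy xn yn hw; have [a [b [Aa nb hab]]] := fP x y n xy xn yn; apply: nb.
  set w := inv (f y) ** f x in hw hab.
  have hz : sublevel (c / 16) (inv (conj w a) ** b).
    by apply: eP; rewrite -(mulV (conj w a)) d_mull.
  rewrite -(mulVK (conj w a) b).
  (* The terms come from [w], [a], [inv w] and the [d]-small correction. Their sum [3 * c / 8] is
     below [c / 2], whereas [b] is outside [sublevel (c / 2)]. *)
  apply: (@sublevelS (c / 8 + c / 16 + c / 8 + c / 16)); first lra.
  apply: sublevelM => //; apply: sublevelM; last exact: sublevelV.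
  exact: sublevelM.
apply: (no_separated_cantor_set c8 (f := f)) => x y /prefix_split[n [xy xyn]].
have [yn|yn] := boolP (y n); first by move=> /sublevel_swap; apply: (sep x y n); rewrite ?xyn ?yn.
by apply: (sep y x n) => //; rewrite xyn.
Qed.

Lemma nbhs_sublevel_usc : (forall c : R, 0 < c -> nbhs one (sublevel c)) -> tau_usc H.
Proof.
move=> hc r; rewrite openE => x /= xr; apply: mul_nbhs_one.
case: HH => H0 _ _ hM.
have Hfin : H x \is a fin_num by rewrite ge0_fin_numE ?H0 // (lt_trans xr) ?ltry.
move: xr; rewrite -(fineK Hfin) lte_fin => xr.
(* Only half of the gap is used, as the sublevel sets are given by non-strict inequalities. *)
have c0 : 0 < (r - fine (H x)) / 2 by lra.
apply: filterS (hc _ c0) => y /= hy; apply: (le_lt_trans (hM _ _)).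
rewrite -(fineK Hfin); apply: (@le_lt_trans _ _ ((fine (H x))%:E + ((r - fine (H x)) / 2)%:E)%E).
  by apply: leeD.
by rewrite -EFinD lte_fin; lra.
Qed.

End GradedSubgroup.
End TopometricGroup.

Theorem theorem4p4 (R : realType) (G : topologicalType)
    (mul : G -> G -> G) (inv : G -> G) (one : G) (d : G -> G -> R)
    (HG : polish_topometric_group mul inv one d)
    (Hample : ample_generics mul inv d)
    (H : G -> \bar R)
    (HH : graded_subgroup mul inv one H)
    (Hlsc : metric_lsc d H)
    (Hidx : index_lt_continuum mul inv H) :
  tau_usc H.
Proof.
case: (HG) => -[_ [sG [m [mM mC mO]]]] _ _ _ _.
have [q qD] := dense_sequence mM mO one sG.
have [good [good0 gext]] := ample_generic_extension HG mM mO qD Hample.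
apply: (nbhs_sublevel_usc HG HH) => c.
exact: (sublevel_nbhs HG HH Hidx Hlsc mM mC mO qD gext good0).
Qed.
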